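(* Let $f_1,\dots,f_T:\mathbb{R}^d\to\mathbb{R}$ be convex and $L$-smooth, let $f=\frac1T\sum_{t=1}^T f_t$, assume $f$ has a minimizer $x_*\in\arg\min f$, and assume $\sigma_*^2:=\frac1T\sum_{t=1}^T\|\nabla f_t(x_* )\|^2$ is bounded. Let $\alpha,\beta>0$ satisfy $\frac1\alpha+\frac1\beta\le\frac12$. If the step size is fixed and satisfies $\eta_k\equiv\eta\le\frac{1}{\sqrt\beta\,TL}$, then the output $x_K$ of the Incremental Proximal Method with inexact proximal point evaluations whose accuracies satisfy $$\sum_{t=1}^T\varepsilon_{k-1,t}\le\frac{\sqrt\eta}{1+(1+\alpha/\beta)(K-k+1)}$$ satisfies $$f(x_K)-f(x_* )\le\frac{\mathrm{e}\|x_0-x_*\|^2}{2\eta TK^{\frac{1}{1+\alpha/\beta}}}+2\eta^2T^2\sigma_*^2L(1+\beta/\alpha)K^{\frac{\alpha/\beta}{1+\alpha/\beta}}+\frac{\mathrm{e}}{2\eta T}\sum_{k=0}^{K-1}\sum_{t=1}^T\frac{2T\varepsilon_{k,t}^2+\sqrt\eta\,\varepsilon_{k,t}}{(K-k)^{\frac{1}{1+\alpha/\beta}}}.$$ Given $\epsilon>0$, if $\sum_{t=1}^T\varepsilon_{k-1,t}\le\sqrt\eta\,\min\Big\{\epsilon,\frac{1}{3(K-k+1)}\Big\}$, there exists $\eta$ such that $f(x_K)-f(x_* )\le\epsilon$ after $$\widetilde{\mathcal{O}}\Big(\frac{TL\|x_0-x_*\|^2}{\epsilon}+\frac{TL^{1/2}\sigma_*\|x_0-x_*\|^2}{\epsilon^{3/2}}\Big)$$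 individual inexact proximal point evaluations.
   Context: $\|\cdot\|$ is the Euclidean norm on $\mathbb{R}^d$. A differentiable $g$ is $L$-smooth if $\|\nabla g(x)-\nabla g(y)\|\le L\|x-y\|$ for all $x,y$. For convex $g$ and $\eta>0$, $\mathrm{prox}_{\eta g}(x)=\arg\min_{y\in\mathbb{R}^d}\{\frac{1}{2\eta}\|y-x\|^2+g(y)\}$, and $M_{\eta g}(x)=\min_{y\in\mathbb{R}^d}\{\frac{1}{2\eta}\|y-x\|^2+g(y)\}$ is the Moreau envelope, with $\nabla M_{\eta g}(x)=\frac1\eta(x-\mathrm{prox}_{\eta g}(x))$. Incremental Proximal Method with inexact proximal point evaluations: given an initial point $x_0\in\mathbb{R}^d$, a number of epochs $K$, step sizes $\eta_k>0$ and accuracies $\varepsilon_{k-1,t}>0$; for $k=1,\dots,K$ set $x_{k-1,1}=x_{k-1}$, then for $t=1,\dots,T$ let $x_{k-1,t+1}$ be an approximation of $\mathrm{prox}_{\eta_kf_t}(x_{k-1,t})$ (obtained by solving the strongly convex proximal subproblem to optimality gap $\varepsilon_{k-1,t}^2/(2\eta_k)$) with $\|x_{k-1,t+1}-\mathrm{prox}_{\eta_kf_t}(x_{k-1,t})\|\le\varepsilon_{k-1,t}$, equivalently $\|g_{k-1,t}-\nabla M_{\eta_kf_t}(x_{k-1,t})\|\le\varepsilon_{k-1,t}/\eta_k$ where $g_{k-1,t}=\frac{1}{\eta_k}(x_{k-1,t}-x_{k-1,t+1})$; finally set $x_k=x_{k-1,T+1}$. The output is $x_K$; each epoch uses $T$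 individual inexact proximal point evaluations, so $K$ epochs use $TK$. The accuracy conditions are imposed for all $1\le k\le K$. The notation $\widetilde{\mathcal O}$ hides logarithmic factors. *)

(* Defs.v *)
From HB Require Import structures.
From mathcomp Require Import all_boot all_order all_algebra.
From mathcomp Require Import all_classical all_reals all_analysis.

Set Implicit Arguments.
Unset Strict Implicit.
Unset Printing Implicit Defensive.

Import Order.TTheory GRing.Theory Num.Theory.
Import numFieldNormedType.Exports.

Local Open Scope classical_set_scope.
Local Open Scope ring_scope.

Section incremental_proximal.
Context {R : realType} {d : nat}.
Implicit Types (g : 'rV[R]_d -> R) (x y p : 'rV[R]_d).

(* The library norm `|x| on 'rV[R]_d is the sup norm, so the Euclidean one is
   defined here. Both induce the same topology, hence the same notion of
   differentiability. *)
Definition enorm x : R := Num.sqrt (\sum_(i < d) x ord0 i ^+ 2).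

Definition grad g x : 'rV[R]_d := \row_(i < d) 'D_(delta_mx ord0 i) g x.

Definition smooth (L : R) g : Prop :=
  (forall x, differentiable g x) /\
  (forall x y, enorm (grad g x - grad g y) <= L * enorm (x - y)).

Definition argmin g : set 'rV[R]_d := [set p | forall y, g p <= g y].

Definition prox (eta : R) g x : set 'rV[R]_d :=
  argmin (fun y => (2 * eta)^-1 * enorm (y - x) ^+ 2 + g y).

Section finite_sum.
Context {T : nat}.
Implicit Types (f : 'I_T -> 'rV[R]_d -> R) (eps : nat -> 'I_T -> R).

Definition favg f : 'rV[R]_d -> R :=
  fun x => T%:R^-1 * \sum_(t < T) f t x.

Definition sigma2 f x : R :=
  T%:R^-1 * \sum_(t < T) enorm (grad (f t) x) ^+ 2.

Definition is_instance f (L : R) (xs : 'rV[R]_d) : Prop :=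
  [/\ (0 < T)%N, 0 < L,
      forall t, convex_function [set: 'rV[R]_d] (f t),
      forall t, smooth L (f t) &
      argmin (favg f) xs].

(* Epochs and components are numbered from 0: for k < K and t < T, the vector
   z k t stands for x_{k, t+1}, eta k for eta_{k+1} and eps k t for
   eps_{k, t+1}; x k is x_k. The set prox is a singleton for convex
   differentiable components. *)
Definition ipm_output f (K : nat) (eta : nat -> R) eps (x0 xK : 'rV[R]_d) :
    Prop :=
  exists (x : nat -> 'rV[R]_d) (z : nat -> nat -> 'rV[R]_d),
    [/\ x 0%N = x0,
        forall k, (k < K)%N ->
          [/\ z k 0%N = x k,
              forall t : 'I_T, exists2 p, prox (eta k) (f t) (z k t) p &
                enorm (z k t.+1 - p) <= eps k t &
              x k.+1 = z k T] &
        xK = x K].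

Definition positive_accuracies (K : nat) eps : Prop :=
  forall k (t : 'I_T), (k < K)%N -> 0 < eps k t.

Definition accuracy1 (K : nat) (alpha beta eta : R) eps : Prop :=
  forall k, (k < K)%N ->
    \sum_(t < T) eps k t <=
      Num.sqrt eta / (1 + (1 + alpha / beta) * (K - k)%:R).

Definition accuracy2 (K : nat) (epsilon eta : R) eps : Prop :=
  forall k, (k < K)%N ->
    \sum_(t < T) eps k t <=
      Num.sqrt eta * Num.min epsilon (3 * (K - k)%:R)^-1.

Definition error_bound f (L : R) (K : nat) (alpha beta eta : R) eps
    (x0 xs : 'rV[R]_d) : R :=
  let r := alpha / beta in
  expR 1 * enorm (x0 - xs) ^+ 2 / (2 * eta * T%:R * K%:R `^ (1 / (1 + r)))
  + 2 * eta ^+ 2 * T%:R ^+ 2 * sigma2 f xs * L * (1 + beta / alpha)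
      * K%:R `^ (r / (1 + r))
  + expR 1 / (2 * eta * T%:R) *
    \sum_(k < K) \sum_(t < T)
      (2 * T%:R * eps k t ^+ 2 + Num.sqrt eta * eps k t)
      / (K - k)%:R `^ (1 / (1 + r)).

Definition complexity f (L epsilon : R) (x0 xs : 'rV[R]_d) : R :=
  T%:R * L * enorm (x0 - xs) ^+ 2 / epsilon
  + T%:R * L `^ (1 / 2) * Num.sqrt (sigma2 f xs) * enorm (x0 - xs) ^+ 2
    / epsilon `^ (3 / 2).

Definition admissible (alpha beta eta L : R) : Prop :=
  [/\ 0 < alpha, 0 < beta, 1 / alpha + 1 / beta <= 1 / 2,
      0 < eta & eta <= 1 / (Num.sqrt beta * T%:R * L)].

End finite_sum.
End incremental_proximal.

(* Soft-O: a quantity N is O~(g) when N <= polylog_bound C p g for constants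
   C and p independent of the instance; the 2 keeps the logarithm positive. *)
Definition polylog_bound {R : realType} (C : R) (p : nat) (g : R) : R :=
  C * g * ln (2 + g) ^+ p.

Arguments admissible {R} T.

(* Main.v *)
Require Import Defs.
From mathcomp Require Import all_boot all_order all_algebra.
From mathcomp Require Import all_classical all_reals all_analysis.
From mathcomp Require Import ring lra.

(* Write h = eta T, r = alpha / beta and delta_k for the total accuracy of epoch
   k. Cocoercivity of the gradients at the proximal points gives, for every
   anchor z, one inequality per epoch:
     2h (f(x+) - fmin) <= 2h (1 + r) (f(z) - fmin) + |x - z|^2 - |x+ - z|^2
                            + 2 delta |x+ - z| + 2hL delta^2 + 2h^3 L sigma^2.
   Moving the anchor towards the current iterate after each epoch and weighting
   the epoch that has j epochs left by a product v_j <= j^(-1/(1+r)) turns these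
   into a last-iterate bound. The moves contract the squared distances slightly
   more than the weights require, and this surplus absorbs the cross terms at
   the price of v_j delta^2 (1 + (1 + r)(j - 1)). For the first claim this is at
   most v_j sqrt(eta) delta. For the complexity, r is taken of order
   1 / log K, so that v_j is about 1 / j and the errors contribute at most a
   constant fraction of (1/T) sum_j min(epsilon, 1/(3j))^2 <= 2 epsilon / (3T).
   If L |x0 - xs|^2 <= 2 epsilon, no epoch is needed at all. *)

Import Order.TTheory GRing.Theory Num.Theory.
Import numFieldNormedType.Exports.

Local Open Scope classical_set_scope.
Local Open Scope ring_scope.

(** * Euclidean inner product and quadratic inequalities *)

Section euclidean.
Context {R : realType} {d : nat}.
Implicit Types (x y z u v : 'rV[R]_d) (a c : R).

Definition dot x y : R := \sum_(i < d) x ord0 i * y ord0 i.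

Lemma dotC x y : dot x y = dot y x.
Proof. by apply: eq_bigr => i _; rewrite mulrC. Qed.

Lemma dotDl x y z : dot (x + y) z = dot x z + dot y z.
Proof. by rewrite -big_split; apply: eq_bigr => i _; rewrite mxE mulrDl. Qed.

Lemma dotZl a x y : dot (a *: x) y = a * dot x y.
Proof. by rewrite mulr_sumr; apply: eq_bigr => i _; rewrite mxE mulrA. Qed.

Lemma dotNl x y : dot (- x) y = - dot x y.
Proof. by rewrite -scaleN1r dotZl mulN1r. Qed.

Lemma dot0l y : dot 0 y = 0.
Proof. by rewrite -(scale0r 0) dotZl mul0r. Qed.

Lemma dotDr x y z : dot x (y + z) = dot x y + dot x z.
Proof. by rewrite dotC dotDl !(dotC _ x). Qed.

Lemma dotZr a x y : dot x (a *: y) = a * dot x y.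
Proof. by rewrite dotC dotZl dotC. Qed.

Lemma dotNr x y : dot x (- y) = - dot x y.
Proof. by rewrite dotC dotNl dotC. Qed.

Lemma dot_suml (I : finType) (P : pred I) (F : I -> 'rV[R]_d) y :
  dot (\sum_(i | P i) F i) y = \sum_(i | P i) dot (F i) y.
Proof.
by elim/big_rec2 : _ => [|i _ u _ <-]; rewrite ?dot0l ?dotDl.
Qed.

Definition dotE := (dotDl, dotDr, dotNl, dotNr, dotZl, dotZr).

Lemma enorm_ge0 x : 0 <= enorm x.
Proof. exact: sqrtr_ge0. Qed.

Lemma sqr_enorm x : enorm x ^+ 2 = dot x x.
Proof.
rewrite sqr_sqrtr; last by apply: sumr_ge0 => i _; exact: sqr_ge0.
by apply: eq_bigr => i _; rewrite expr2.
Qed.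

Lemma dotxx_ge0 x : 0 <= dot x x.
Proof. by rewrite -sqr_enorm sqr_ge0. Qed.

Lemma dotxx_le0_eq0 x : dot x x <= 0 -> x = 0.
Proof.
move=> xx; have /eqP : dot x x = 0 by apply/le_anti; rewrite xx dotxx_ge0.
rewrite psumr_eq0 => [/allP x0|i _]; last by rewrite -expr2 sqr_ge0.
apply/rowP => i; have := x0 i (mem_index_enum i).
by rewrite /= mulf_eq0 orbb mxE => /eqP.
Qed.

(** Cauchy-Schwarz: expand the square of [dot y y *: x - dot x y *: y] and divide by [dot y y]. *)
Lemma sqr_dot_le x y : dot x y ^+ 2 <= dot x x * dot y y.
Proof.
have [y0|y0] := eqVneq (dot y y) 0.
  have -> : y = 0 by apply: dotxx_le0_eq0; rewrite y0.
  by rewrite dotC !dot0l mulr0 expr0n.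
have yy : 0 < dot y y by rewrite lt_neqAle eq_sym y0 dotxx_ge0.
have := dotxx_ge0 (dot y y *: x - dot x y *: y).
rewrite !dotE (dotC y x) => H.
have : 0 <= dot y y * (dot x x * dot y y - dot x y ^+ 2) by lra.
by rewrite pmulr_rge0// subr_ge0.
Qed.

Lemma dot_le_enorm x y : dot x y <= enorm x * enorm y.
Proof.
apply: le_trans (ler_norm _) _.
rewrite -(@ler_pXn2r _ 2)// ?nnegrE ?mulr_ge0 ?enorm_ge0//.
by rewrite exprMn !sqr_enorm real_normK ?num_real// sqr_dot_le.
Qed.

Lemma enormD x y : enorm (x + y) <= enorm x + enorm y.
Proof.
rewrite -(@ler_pXn2r _ 2)// ?nnegrE ?addr_ge0 ?enorm_ge0//.
rewrite sqr_enorm !dotE (dotC y x) sqrrD !sqr_enorm.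
by have := dot_le_enorm x y; lra.
Qed.

Lemma enorm0 : enorm (0 : 'rV[R]_d) = 0.
Proof. by apply/eqP; rewrite -sqrf_eq0 sqr_enorm dot0l. Qed.

Lemma enorm_sum (I : finType) (P : pred I) (F : I -> 'rV[R]_d) :
  enorm (\sum_(i | P i) F i) <= \sum_(i | P i) enorm (F i).
Proof.
elim/big_rec2 : _ => [|i x y _ h]; first by rewrite enorm0.
by apply: le_trans (enormD _ _) _; rewrite lerD2l.
Qed.

Lemma enormZ a x : enorm (a *: x) = `|a| * enorm x.
Proof.
apply: (@pexpIrn _ 2); rewrite ?nnegrE ?mulr_ge0 ?enorm_ge0//.
by rewrite exprMn real_normK ?num_real// !sqr_enorm !dotE; ring.
Qed.

Lemma sqr_enorm_add2 x y : dot (x + y) (x + y) <= 2 * dot x x + 2 * dot y y.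
Proof.
have := dotxx_ge0 (x - y); rewrite !dotE (dotC y x) => h; lra.
Qed.

(** A weighted Young inequality, through which the constraint on [alpha] and [beta] enters.
    Multiplied by [c - 2], the gap is half the square of [(c - 2) *: x - 2 *: y] plus half of
    [(a * c - 2 * (a + c)) * dot y y], and the constraint makes the latter nonnegative. *)
Lemma sqr_enorm_addw a c x y : 0 < a -> 0 < c -> 1 / a + 1 / c <= 1 / 2 ->
  dot (x + y) (x + y) <= c / 2 * dot x x + a / 2 * dot y y.
Proof.
move=> a0 c0 h.
have H : 2 * (a + c) <= a * c.
  have ac : 0 < 2 * (a * c) by rewrite !mulr_gt0.
  have := ler_wpM2l (ltW ac) h.
  by rewrite (_ : _ * (1 / a + _) = 2 * (a + c)) 1?(_ : _ * (1 / 2) = a * c)//;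
    field; rewrite ?gt_eqF.
have c2 : 0 < c - 2 by nra.
rewrite !dotE (dotC y x).
have := dotxx_ge0 ((c - 2) *: x - 2 *: y); rewrite !dotE (dotC y x) => Q.
have yy := dotxx_ge0 y.
rewrite -subr_ge0 -(pmulr_rge0 _ c2).
have : 0 <= (a * c - 2 * (a + c)) * dot y y by rewrite mulr_ge0// subr_ge0.
nra.
Qed.

(** A variance argument: the squares of the deviations [#|P|%:R *: F i - S] have a nonnegative
    sum. *)
Lemma sqr_enorm_sum (I : finType) (P : pred I) (F : I -> 'rV[R]_d) :
  dot (\sum_(i | P i) F i) (\sum_(i | P i) F i)
  <= #|P|%:R * \sum_(i | P i) dot (F i) (F i).
Proof.
set S := \sum_(i | P i) F i.
have [P0|P0] := posnP #|P|.
  have -> : S = 0 by rewrite /S big_pred0// => i; have := card0_eq P0 i.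
  by rewrite dot0l P0 mul0r.
have n0 : 0 < #|P|%:R :> R by rewrite ltr0n.
have : 0 <= \sum_(i | P i) dot (#|P|%:R *: F i - S) (#|P|%:R *: F i - S).
  by apply: sumr_ge0 => i _; exact: dotxx_ge0.
have -> : \sum_(i | P i) dot (#|P|%:R *: F i - S) (#|P|%:R *: F i - S) =
    #|P|%:R * (#|P|%:R * \sum_(i | P i) dot (F i) (F i)) -
    2 * #|P|%:R * dot S S + #|P|%:R * dot S S.
  have C : \sum_(i | P i) dot S S = #|P|%:R * dot S S.
    by rewrite big_const iter_addr addr0 mulr_natl.
  have E : dot S S = \sum_(i | P i) dot (F i) S by rewrite {1}/S dot_suml.
  under eq_bigr => i _ do rewrite !dotE (dotC S (F i)).
  rewrite big_split /= sumrN -mulr_sumr !sumrB -!mulr_sumr C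
    -E; ring.
by move=> h; rewrite -(ler_pM2l n0); lra.
Qed.

End euclidean.

(** * Directional derivatives and the quadratic Taylor bound *)

Section taylor.
Context {R : realType} {d : nat}.
Implicit Types (x y z u v : 'rV[R]_d) (a c : R) (g : 'rV[R]_d -> R).

Lemma derive_dot_grad g x v : differentiable g x -> 'D_v g x = dot (grad g x) v.
Proof.
move=> dg; rewrite deriveE// {1}(row_sum_delta v) linear_sum.
apply: eq_bigr => i _; rewrite linearZ /= mxE deriveE//.
by rewrite mulrC.
Qed.

Lemma is_derive_line g x v a : differentiable g (x + a *: v) ->
  is_derive a 1 (fun s : R => g (x + s *: v)) (dot (grad g (x + a *: v)) v).
Proof.
move=> dg; have E : (fun t : R => t^-1 *:
    (((fun s : R => g (x + s *: v)) \o shift a) (t *: 1) - g (x + a *: v))) =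
  (fun t : R => t^-1 *: ((g \o shift (x + a *: v)) (t *: v) - g (x + a *: v))).
  apply/funext => t /=; congr (_ *: (g _ - _)).
  by rewrite [_ *: 1]mulr1 scalerDl addrCA.
apply: DeriveDef; first by rewrite /derivable E; exact: diff_derivable.
by rewrite -derive_dot_grad// /derive E.
Qed.

(** Mean value theorem for [phi] on [0, 1]: the Lipschitz gradient makes its derivative nonpositive
    inside the interval. The sign [c], taken as 1 and as -1, gives both sides of the absolute
    value. *)
Lemma smooth_taylor g (L : R) x y : 0 < L -> smooth L g ->
  `|g y - g x - dot (grad g x) (y - x)| <= L / 2 * enorm (y - x) ^+ 2.
Proof.
move=> L0 [dg lg]; set v := y - x.
have key c : `|c| = 1 ->
    c * (g y - g x - dot (grad g x) v) <= L / 2 * enorm v ^+ 2.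
  move=> c1; pose phi (s : R) : R := c * (g (x + s *: v) - s * dot (grad g x) v)
    - L / 2 * enorm v ^+ 2 * s ^+ 2.
  pose dphi (s : R) : R := c * (dot (grad g (x + s *: v)) v - dot (grad g x) v)
    - L * enorm v ^+ 2 * s.
  have D (s : R) : is_derive s (1 : R) phi (dphi s).
    have Dg := is_derive_line g x v s (dg _).
    set G := (fun s : R => g (x + s *: v)) in Dg.
    have I := is_derive_id s (1 : R).
    have := is_deriveB (is_deriveZ c (is_deriveB Dg
      (is_deriveZ (dot (grad g x) v) I)))
      (is_deriveZ (L / 2 * enorm v ^+ 2) (is_deriveX 2 I)).
    set F := (X in is_derive _ _ X _); have -> : F = phi.
      apply/funext => t; rewrite /F /phi /G !fctE /= /GRing.scale /=.
      by congr (_ - _); congr (_ * (_ - _)); rewrite mulrC.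
    move=> DF; apply: (is_derive_eq DF).
    by rewrite /dphi /GRing.scale /= !mulr1 expr1; field.
  have cphi : {within `[0, 1], continuous phi}.
    by apply: derivable_within_continuous => s _; exact: ex_derive.
  have [s /[!in_itv]/= /andP[s0 s1]] := MVT ltr01 (fun s _ => D s) cphi.
  rewrite subr0 mulr1 /phi /dphi scale1r scale0r addr0 /v.
  rewrite [x + (y - x)]addrC subrK -/v => E.
  have : c * (dot (grad g (x + s *: v)) v - dot (grad g x) v) <=
      L * enorm v ^+ 2 * s.
    apply: le_trans (ler_norm _) _; rewrite normrM c1 mul1r -dotNl -dotDl.
    have h1 := lg (x + s *: v) x.
    have E2 : x + s *: v - x = s *: v by rewrite addrC addKr.
    rewrite E2 enormZ (gtr0_norm s0) in h1.
    have h2 w : `|dot w v| <= enorm w * enorm v.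
      rewrite ler_norml -lerNl -dotNl dot_le_enorm andbT.
      rewrite -[enorm w]mul1r -[X in X * enorm w](@normrN1 R) -enormZ scaleN1r.
      exact: dot_le_enorm.
    apply: le_trans (h2 _) _.
    by have := ler_wpM2r (enorm_ge0 v) h1; lra.
  lra.
rewrite ler_norml; have := key 1 (normr1 _); have := key (-1) (normrN1 _).
by rewrite mul1r mulN1r => h1 h2; apply/andP; split; lra.
Qed.
End taylor.

(** * Smooth convex functions: first-order inequalities and proximal points *)

Section smooth_convex.
Context {R : realType} {d : nat}.
Implicit Types (x y z u v p : 'rV[R]_d) (g : 'rV[R]_d -> R) (L eta a : R).

Lemma convex_functionE g (t : R) x y : convex_function [set: 'rV[R]_d] g ->
  0 <= t -> t <= 1 -> g (t *: x + (1 - t) *: y) <= t * g x + (1 - t) * g y.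
Proof.
by move=> cg t0 t1; apply: (cg (Itv01 t0 t1)); rewrite in_setT.
Qed.

(** Convexity on the segment and the Taylor bound give [0 <= A + s * M] for all [s] in ]0, 1], which
    a negative gap [A] contradicts for small [s]. *)
Lemma smooth_convex_ge g L x y : 0 < L -> smooth L g ->
  convex_function [set: 'rV[R]_d] g -> g x + dot (grad g x) (y - x) <= g y.
Proof.
move=> L0 sg cg; rewrite leNgt; apply/negP => lt_gy.
set A := g y - g x - dot (grad g x) (y - x).
set M := L / 2 * enorm (y - x) ^+ 2.
have A0 : A < 0 by rewrite /A; lra.
have M0 : 0 <= M by rewrite mulr_ge0 ?sqr_ge0// divr_ge0// ltW.
have MA : 0 < M - A by lra.
(* For this [s], [A + s * M = - A ^+ 2 / (M - A) < 0]. *)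
pose s := - A / (M - A).
have s0 : 0 < s by rewrite divr_gt0// oppr_gt0.
have s1 : s <= 1 by rewrite ler_pdivrMr// mul1r; lra.
have sE : s * (M - A) = - A by rewrite /s divfK// gt_eqF.
have := convex_functionE g s y x cg (ltW s0) s1.
have -> : s *: y + (1 - s) *: x = x + s *: (y - x).
  by apply/rowP => i; rewrite !mxE; ring.
have := smooth_taylor g L x (x + s *: (y - x)) L0 sg.
have -> : x + s *: (y - x) - x = s *: (y - x) by rewrite addrC addKr.
rewrite ler_norml enormZ (gtr0_norm s0) exprMn dotZr => /andP[+ _].
rewrite [L / 2 * _]mulrCA -/M => h1 h2.
have h3 : 0 <= s * (A + s * M) by rewrite /A; lra.
move: h3; rewrite pmulr_rge0// => h3.
have h4 : 0 <= (A + s * M) * (M - A) by rewrite mulr_ge0// ltW.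
nra.
Qed.

(** Evaluate [g] at [y - L^-1 *: D], a gradient step from [y] for [g] minus its tangent at [x]: the
    tangent at [x] bounds the value from below, the Taylor bound at [y] from above. *)
Lemma smooth_convex_cocoercive g L x y : 0 < L -> smooth L g ->
  convex_function [set: 'rV[R]_d] g ->
  g x + dot (grad g x) (y - x)
  + (2 * L)^-1 * dot (grad g y - grad g x) (grad g y - grad g x) <= g y.
Proof.
move=> L0 sg cg; set D := grad g y - grad g x.
have := smooth_convex_ge g L x (y - L^-1 *: D) L0 sg cg.
have := smooth_taylor g L y (y - L^-1 *: D) L0 sg.
have -> : y - L^-1 *: D - y = - L^-1 *: D by rewrite addrC addKr scaleNr.
have -> : y - L^-1 *: D - x = (y - x) - L^-1 *: D by rewrite addrAC.
rewrite ler_norml sqr_enorm => /andP[_]; rewrite ![dot _ (_ *: _)]dotZr.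
rewrite [dot (grad g x) (_ - _)]dotDr dotNr !dotZr !dotZl => h1 h2.
have DE : dot D D = dot (grad g y) D - dot (grad g x) D.
  by rewrite {1}/D dotDl dotNl.
have LE : L / 2 * (- L^-1 * (- L^-1 * dot D D)) = (2 * L)^-1 * dot D D.
  by field; rewrite gt_eqF.
rewrite LE in h1.
have LE2 : L^-1 * dot D D = 2 * ((2 * L)^-1 * dot D D).
  by field; rewrite gt_eqF.
have : L^-1 * dot D D = L^-1 * dot (grad g y) D - L^-1 * dot (grad g x) D.
  by rewrite DE mulrBr.
lra.
Qed.

(** First-order optimality, in a form that serves both the proximal subproblem and [favg]: if [v] is
    the gradient at a minimizer, a step [s] along [- v] cannot decrease the objective. At
    [s = (2 * M)^-1] the right-hand side is [- (4 * M)^-1 * dot v v]. *)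
Lemma descent_eq0 v (M : R) : 0 < M ->
  (forall s : R, 0 < s -> 0 <= - s * dot v v + s ^+ 2 * (M * dot v v)) -> v = 0.
Proof.
move=> M0 h; apply: dotxx_le0_eq0; rewrite leNgt; apply/negP => v0.
have s0 : 0 < (2 * M)^-1 by rewrite invr_gt0 mulr_gt0.
have := h _ s0.
have -> : - (2 * M)^-1 * dot v v + (2 * M)^-1 ^+ 2 * (M * dot v v)
    = - ((4 * M)^-1 * dot v v) by field; rewrite gt_eqF.
by rewrite oppr_ge0 leNgt mulr_gt0// invr_gt0 mulr_gt0.
Qed.

(** Stationarity of the proximal objective: its gradient at [p] is [w], and comparing [p] with
    [p - s *: w] forces [w = 0]. *)
Lemma prox_grad g L eta x p : 0 < L -> smooth L g -> 0 < eta ->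
  prox eta g x p -> p = x - eta *: grad g p.
Proof.
move=> L0 sg eta0 hp; 
  have [w wE] : exists w, w = grad g p + eta^-1 *: (p - x) by eexists.
suff w0 : w = 0.
  have : eta *: w = 0 by rewrite w0 scaler0.
  rewrite wE scalerDr scalerA divff ?gt_eqF// scale1r => h.
  by apply/eqP; rewrite -subr_eq0 -h; apply/eqP/rowP => i; rewrite !mxE; ring.
apply: (@descent_eq0 _ (L / 2 + (2 * eta)^-1)) => [|s s0].
  by rewrite addr_gt0 ?divr_gt0// invr_gt0 mulr_gt0.
have := hp (p - s *: w).
have := smooth_taylor g L p (p - s *: w) L0 sg.
have -> : p - s *: w - p = - s *: w by rewrite addrC addKr scaleNr.
have -> : p - s *: w - x = (p - x) - s *: w by rewrite addrAC.
rewrite ler_norml !sqr_enorm => /andP[_]; rewrite !dotE.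
rewrite (dotC w p) (dotC w x) => h1.
set q := dot w w in h1 *; set q1 := dot (grad g p) w in h1 *.
have qE : q = q1 + eta^-1 * (dot p w - dot x w).
  by rewrite /q {1}wE dotDl dotZl dotDl dotNl.
have e0 : 0 < eta^-1 by rewrite invr_gt0.
rewrite !invfM => h2.
nra.
Qed.

End smooth_convex.

(** * Averages of components, optimality of [xs] and tail sums *)

Section finite_sum.
Context {R : realType} {d T : nat}.
Implicit Types (f : 'I_T -> 'rV[R]_d -> R) (x y z w : 'rV[R]_d) (L : R).

Lemma mulr_favg f x : (0 < T)%N -> T%:R * favg f x = \sum_(t < T) f t x.
Proof. by move=> T0; rewrite /favg mulrA divff ?mul1r// pnatr_eq0 -lt0n. Qed.

Lemma mulr_sigma2 f x : (0 < T)%N ->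
  T%:R * sigma2 f x = \sum_(t < T) dot (grad (f t) x) (grad (f t) x).
Proof.
move=> T0; rewrite /sigma2 mulrA divff ?mul1r ?pnatr_eq0 -?lt0n//.
by apply: eq_bigr => t _; rewrite sqr_enorm.
Qed.

Lemma favg_convex f (a : R) x y :
  (forall t, convex_function [set: 'rV[R]_d] (f t)) -> 0 <= a -> a <= 1 ->
  favg f (a *: x + (1 - a) *: y) <= a * favg f x + (1 - a) * favg f y.
Proof.
move=> cf a0 a1; rewrite /favg [a * _]mulrCA [(1 - a) * _]mulrCA -mulrDr.
rewrite ler_wpM2l ?invr_ge0// !mulr_sumr -big_split; apply: ler_sum => t _.
exact: convex_functionE.
Qed.

Lemma sum_taylor_le f L x y : 0 < L -> (forall t, smooth L (f t)) ->
  \sum_(t < T) f t y <= \sum_(t < T) f t x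
    + dot (\sum_(t < T) grad (f t) x) (y - x)
    + T%:R * (L / 2 * dot (y - x) (y - x)).
Proof.
move=> L0 sf; rewrite dot_suml.
have -> : T%:R * (L / 2 * dot (y - x) (y - x)) =
    \sum_(t < T) (L / 2 * dot (y - x) (y - x)).
  by rewrite sumr_const card_ord mulr_natl.
rewrite -!big_split; apply: ler_sum => t _ /=.
have := smooth_taylor (f t) L x y L0 (sf t).
by rewrite ler_norml sqr_enorm => /andP[_]; lra.
Qed.

Lemma sum_grad_argmin f L xs : is_instance f L xs ->
  \sum_(t < T) grad (f t) xs = 0.
Proof.
case=> T0 L0 cf sf mf.
have [v vE] : exists v, v = \sum_(t < T) grad (f t) xs by eexists.
have TR : 0 < T%:R :> R by rewrite ltr0n.
rewrite -vE; apply: (@descent_eq0 _ _ _ (T%:R * (L / 2))) => [|s s0].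
  by rewrite mulr_gt0// divr_gt0.
have := sum_taylor_le f L xs (xs - s *: v) L0 sf.
have := ler_wpM2l (ltW TR) (mf (xs - s *: v)).
rewrite !mulr_favg// -vE.
have -> : xs - s *: v - xs = - s *: v by rewrite addrC addKr scaleNr.
by rewrite !dotE; lra.
Qed.

(** The linear term of the Taylor bound at [xs] vanishes. This settles the case where no epoch is
    run. *)
Lemma favg_sub_le f L xs x : is_instance f L xs ->
  favg f x - favg f xs <= L / 2 * enorm (x - xs) ^+ 2.
Proof.
move=> I; have g0 := sum_grad_argmin _ _ _ I.
case: I => T0 L0 cf sf mf.
have TR : 0 < T%:R :> R by rewrite ltr0n.
have := sum_taylor_le f L xs x L0 sf.
rewrite g0 dot0l addr0 -!mulr_favg// -mulrDr ler_pM2l// sqr_enorm.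
lra.
Qed.

(** Cocoercivity between [xs] and [w] for each component; the linear terms cancel in the sum because
    the gradients at [xs] add up to 0. *)
Lemma sum_sqr_grad_sub f L xs w : is_instance f L xs ->
  \sum_(t < T) dot (grad (f t) w - grad (f t) xs) (grad (f t) w - grad (f t) xs)
  <= 2 * L * T%:R * (favg f w - favg f xs).
Proof.
move=> I; have g0 := sum_grad_argmin _ _ _ I.
case: I => T0 L0 cf sf mf.
rewrite -[2 * L * _ * _]mulrA mulrBr !mulr_favg// -sumrB mulr_sumr.
have -> : \sum_(t < T) 2 * L * (f t w - f t xs) =
  \sum_(t < T) 2 * L * (f t w - f t xs - dot (grad (f t) xs) (w - xs)).
  rewrite -!mulr_sumr; congr (_ * _).
  by rewrite [RHS]sumrB -dot_suml g0 dot0l subr0.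
apply: ler_sum => t _.
have := smooth_convex_cocoercive (f t) L xs w L0 (sf t) (cf t).
set q := dot _ (_ - _ : 'rV_d) => h.
have L2 : 0 < 2 * L by rewrite mulr_gt0.
move: h; set Q := dot (grad (f t) w - _) _ => h.
have {h} : (2 * L)^-1 * Q <= f t w - f t xs - q by lra.
by rewrite mulrC ler_pdivrMr// mulrC.
Qed.

(** The tail after [t] has [T - t.+1] terms, so its square costs that factor, and these factors add
    up to T(T-1)/2. *)
Lemma sum_sqr_tail_sum (a : 'I_T -> 'rV[R]_d) :
  \sum_(t < T) dot (\sum_(s < T | (t < s)%N) a s) (\sum_(s < T | (t < s)%N) a s)
  <= T%:R ^+ 2 / 2 * \sum_(s < T) dot (a s) (a s).
Proof.
set S := \sum_(s < T) dot (a s) (a s).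
have h (t : 'I_T) : dot (\sum_(s < T | (t < s)%N) a s)
    (\sum_(s < T | (t < s)%N) a s) <= (T - t.+1)%:R * S.
  apply: le_trans (sqr_enorm_sum _ _ _) _; apply: ler_pM => //.
  - by apply: sumr_ge0 => s _; exact: dotxx_ge0.
  - rewrite ler_nat -sum1_card -[leqRHS]muln1 -sum_nat_const_nat big_geq_mkord.
    by apply: eq_leq; apply: eq_bigl => s.
  - rewrite big_mkcond; apply: ler_sum => s _.
    by case: ifP => // _; exact: dotxx_ge0.
apply: (@le_trans _ _ (\sum_(t < T) (T - t.+1)%:R * S)).
  by apply: ler_sum => t _; exact: h.
rewrite -mulr_suml ler_wpM2r//.
  by apply: sumr_ge0 => s _; exact: dotxx_ge0.
rewrite (reindex_inj rev_ord_inj) /=.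
under eq_bigr => t _ do rewrite subnSK// subKn ?(ltnW (ltn_ord _))//.
elim: (T) => [|n ih]; first by rewrite big_ord0 expr0n mul0r.
by rewrite big_ord_recr /= -natr1; move: ih; have := ler0n R n; nra.
Qed.

Lemma tail_telescope (z : nat -> 'rV[R]_d) (m : nat) : (m <= T)%N ->
  z T - z m = \sum_(s < T | (m <= s)%N) (z s.+1 - z s).
Proof.
move=> mT; rewrite -(telescope_sumr z mT) big_geq_mkord.
by apply: eq_bigl => s.
Qed.

(** Telescoping from [z t] to [z T]. The gradient of index [t] is already contained in [p t], so the
    gradients run over [t < s]; the error of step [t] is not, so the errors run over [t <= s]. *)
Lemma sub_prox_tail eta f (z : nat -> 'rV[R]_d) (p : 'I_T -> 'rV[R]_d)
    (g : 'I_T -> 'rV[R]_d) (t : 'I_T) :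
  (forall s : 'I_T, p s = z s - eta *: g s) ->
  z T - p t = - eta *: \sum_(s < T | (t < s)%N) g s
    + \sum_(s < T | (t <= s)%N) (z s.+1 - p s).
Proof.
move=> hp; have := tail_telescope z t (ltnW (ltn_ord t)).
have -> : \sum_(s < T | (t <= s)%N) (z s.+1 - z s) =
  \sum_(s < T | (t <= s)%N) (z s.+1 - p s)
    - eta *: \sum_(s < T | (t <= s)%N) g s.
  rewrite scaler_sumr -sumrB; apply: eq_bigr => s _.
  by rewrite hp; apply/rowP => i; rewrite !mxE; ring.
rewrite [X in _ - eta *: X](bigD1 t)//= => h.
have -> : \sum_(s < T | (t < s)%N) g s =
    \sum_(i < T | (t <= i)%N && (i != t)) g i.
  by apply: eq_bigl => s; rewrite ltn_neqAle andbC eq_sym.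
have -> : z T - p t = (z T - z t) + eta *: g t.
  by rewrite hp; apply/rowP => i; rewrite !mxE; ring.
by rewrite h; apply/rowP => i; rewrite !mxE; ring.
Qed.

End finite_sum.

(** * The inequality for one epoch of inexact proximal steps *)

Section inexact_epoch.
Context {R : realType} {d T : nat}.
Implicit Types (f : 'I_T -> 'rV[R]_d -> R) (x y z w : 'rV[R]_d) (L : R).

Lemma admissible_sqr (alpha beta eta L : R) : (0 < T)%N -> 0 < L ->
  admissible T alpha beta eta L -> beta * (eta * T%:R * L) ^+ 2 <= 1.
Proof.
move=> T0 L0 [a0 b0 ab e0 he].
have TR : 0 < T%:R :> R by rewrite ltr0n.
have sb : 0 < Num.sqrt beta by rewrite sqrtr_gt0.
have h : Num.sqrt beta * (eta * T%:R * L) <= 1.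
  move: he; rewrite ler_pdivlMr ?mulr_gt0//; lra.
rewrite -(sqr_sqrtr (ltW b0)) -exprMn exprn_ile1// mulr_ge0 ?ltW//.
by rewrite !mulr_gt0.
Qed.

Section one_epoch.
Variables (f : 'I_T -> 'rV[R]_d -> R) (L : R) (xs : 'rV[R]_d).
Variables (alpha beta eta : R).
Hypotheses (I : is_instance f L xs) (A : admissible T alpha beta eta L).
Variables (z : nat -> 'rV[R]_d) (p : 'I_T -> 'rV[R]_d) (e : 'I_T -> R).
Hypothesis hp : forall t : 'I_T, prox eta (f t) (z t) (p t).
Hypothesis he : forall t : 'I_T, enorm (z t.+1 - p t) <= e t.

Local Notation delta := (\sum_(t < T) e t).

(** The gradients at the proximal points are split through [w] and [xs] into three tails, weighted
    so that [a] can be paid by cocoercivity, [b] by the gap at [w] and [c] by the variance at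
    [xs]. *)
Lemma sqr_sub_prox (w : 'rV[R]_d) (t : 'I_T) :
  let: g := fun s : 'I_T => grad (f s) (p s) in
  let: a := \sum_(s < T | (t < s)%N) (g s - grad (f s) w) in
  let: b := \sum_(s < T | (t < s)%N) (grad (f s) w - grad (f s) xs) in
  let: c := \sum_(s < T | (t < s)%N) grad (f s) xs in
  dot (z T - p t) (z T - p t) <= 2 * beta * eta ^+ 2 * dot a a
    + 2 * alpha * eta ^+ 2 * dot b b + 4 * eta ^+ 2 * dot c c + 2 * delta ^+ 2.
Proof.
case: I => T0 L0 cf sf mf; case: A => a0 b0 ab e0 eL.
have hg s := prox_grad (f s) L eta (z s) (p s) L0 (sf s) e0 (hp s).
rewrite (@sub_prox_tail _ _ _ eta f z p (fun s => grad (f s) (p s)))//.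
set a := \sum_(s < T | (t < s)%N) (_ - grad (f s) w).
set b := \sum_(s < T | (t < s)%N) (_ - grad (f s) xs).
set c := \sum_(s < T | (t < s)%N) grad (f s) xs.
set E := \sum_(s < T | (t <= s)%N) _.
have -> : \sum_(s < T | (t < s)%N) grad (f s) (p s) = a + b + c.
  by rewrite -!big_split; apply: eq_bigr => s _ /=; rewrite subrKA subrK.
have hE : dot E E <= delta ^+ 2.
  rewrite -sqr_enorm ler_pXn2r ?nnegrE ?enorm_ge0//; last first.
    by apply: sumr_ge0 => s _; exact: le_trans (enorm_ge0 _) (he s).
  apply: le_trans (enorm_sum _ _ _) _.
  rewrite big_mkcond; apply: ler_sum => s _; case: ifP => _ //.
  exact: le_trans (enorm_ge0 _) (he s).
apply: le_trans (sqr_enorm_add2 _ _) _.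
rewrite !dotZl !dotZr.
have h1 := sqr_enorm_add2 (a + b) c.
have h2 := sqr_enorm_addw _ _ a b a0 b0 ab.
have h3 : dot (a + b + c) (a + b + c) <=
  beta * dot a a + alpha * dot b b + 2 * dot c c by lra.
have := ler_wpM2l (sqr_ge0 eta) h3.
lra.
Qed.

Lemma epoch_descent (w : 'rV[R]_d) :
  2 * (eta * T%:R) * (favg f (z T) - favg f w) <=
    enorm (z 0%N - w) ^+ 2 - enorm (z T - w) ^+ 2 + 2 * delta * enorm (z T - w)
    + (2 * (eta * T%:R) * L * delta ^+ 2
       + 2 * (eta * T%:R) ^+ 3 * L * sigma2 f xs)
    + 2 * (eta * T%:R) * (alpha / beta) * (favg f w - favg f xs).
Proof.
have hsq t := sqr_sub_prox w t.
have hS := admissible_sqr _ _ _ _ _ _ A.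
have hB := sum_sqr_grad_sub _ _ _ w I.
case: I => T0 L0 cf sf mf; case: A => a0 b0 ab e0 eL.
have {}hS := hS T0 L0.
have hg s := prox_grad (f s) L eta (z s) (p s) L0 (sf s) e0 (hp s).
have TR : 0 < T%:R :> R by rewrite ltr0n.
set g := fun s : 'I_T => grad (f s) (p s) in hsq.
set SA := \sum_(s < T) dot (g s - grad (f s) w) (g s - grad (f s) w).
set SB := \sum_(t < T) dot _ _ in hB.
set SC := \sum_(s < T) dot (grad (f s) xs) (grad (f s) xs).
set h := eta * T%:R.
have h0 : 0 < h by rewrite mulr_gt0.
have SA0 : 0 <= SA by apply: sumr_ge0 => s _; exact: dotxx_ge0.
(* Smoothness bounds [f t (z T)] from [p t], cocoercivity bounds [f t w] from [p t], and the two
   linear terms merge. The negative square is kept to cancel [SA] later. *)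
have per_t t : f t (z T) - f t w <= dot (g t) (z T - w)
    + L / 2 * dot (z T - p t) (z T - p t)
    - (2 * L)^-1 * dot (g t - grad (f t) w) (g t - grad (f t) w).
  have := smooth_taylor (f t) L (p t) (z T) L0 (sf t).
  rewrite ler_norml sqr_enorm => /andP[_ u1].
  have := smooth_convex_cocoercive (f t) L (p t) w L0 (sf t) (cf t).
  have -> : dot (grad (f t) w - grad (f t) (p t))
      (grad (f t) w - grad (f t) (p t)) =
      dot (g t - grad (f t) w) (g t - grad (f t) w).
    by rewrite -[grad (f t) w - _]opprB dotNl dotNr opprK.
  move: u1; rewrite -/(g t) => u1 u2.
  have : dot (g t) (z T - w) = dot (g t) (z T - p t) - dot (g t) (w - p t).
    by rewrite -dotNr -dotDr opprB addrA subrK.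
  lra.
have sum_t : \sum_(t < T) f t (z T) - \sum_(t < T) f t w <=
    dot (\sum_(t < T) g t) (z T - w)
    + L / 2 * (beta * eta ^+ 2 * T%:R ^+ 2 * SA
       + alpha * eta ^+ 2 * T%:R ^+ 2 * SB
       + 2 * eta ^+ 2 * T%:R ^+ 2 * SC + T%:R * (2 * delta ^+ 2))
    - (2 * L)^-1 * SA.
  rewrite -sumrB; apply: (@le_trans _ _ (\sum_(t < T) (dot (g t) (z T - w)
      + L / 2 * dot (z T - p t) (z T - p t)
      - (2 * L)^-1 * dot (g t - grad (f t) w) (g t - grad (f t) w)))).
    by apply: ler_sum => t _; exact: per_t.
  rewrite sumrB big_split /= -!mulr_sumr -dot_suml lerB// lerD2l.
  rewrite ler_wpM2l ?divr_ge0 ?(ltW L0)//.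
  apply: le_trans (ler_sum _ (fun t _ => hsq t)) _.
  rewrite !big_split /= -!mulr_sumr sumr_const card_ord -[_ *+ T]mulr_natl.
  have tA := sum_sqr_tail_sum (fun s => g s - grad (f s) w).
  have tB := sum_sqr_tail_sum (fun s => grad (f s) w - grad (f s) xs).
  have tC := sum_sqr_tail_sum (fun s => grad (f s) xs).
  have c1 : 0 <= 2 * beta * eta ^+ 2 by rewrite !mulr_ge0 ?ltW// exprn_gt0.
  have c2 : 0 <= 2 * alpha * eta ^+ 2 by rewrite !mulr_ge0 ?ltW// exprn_gt0.
  have c3 : 0 <= 4 * eta ^+ 2 by rewrite !mulr_ge0 ?ltW// exprn_gt0.
  have := ler_wpM2l c1 tA; have := ler_wpM2l c2 tB; have := ler_wpM2l c3 tC.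
  rewrite -/SA -/SB -/SC.
  lra.
(* The scaled gradients add up to the displacement of the epoch plus the total error. With [u] and
   [v] the distances to [w], [2 * dot (u - v) v] is at most [dot u u - dot v v]. *)
have dist : 2 * dot (eta *: \sum_(t < T) g t) (z T - w) <=
    enorm (z 0%N - w) ^+ 2 - enorm (z T - w) ^+ 2
    + 2 * delta * enorm (z T - w).
  have -> : eta *: \sum_(t < T) g t =
      (z 0%N - z T) + \sum_(t < T) (z t.+1 - p t).
    have -> : z 0%N - z T = - \sum_(s < T) (z s.+1 - z s).
      by rewrite -(tail_telescope z 0)// opprB.
    rewrite -sumrN -big_split scaler_sumr; apply: eq_bigr => t _ /=.
    by rewrite [p t in RHS]hg -/(g t); apply/rowP => i; rewrite !mxE; ring.
  rewrite dotDl.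
  have : dot (\sum_(t < T) (z t.+1 - p t)) (z T - w) <= delta * enorm (z T - w).
    apply: le_trans (dot_le_enorm _ _) _; rewrite ler_wpM2r ?enorm_ge0//.
    by apply: le_trans (enorm_sum _ _ _) _; apply: ler_sum => t _.
  have -> : z 0%N - z T = (z 0%N - w) - (z T - w) by rewrite opprB addrA subrK.
  have := dotxx_ge0 (z 0%N - w - (z T - w)).
  rewrite !sqr_enorm; move: (z 0%N - w) (z T - w) => u v.
  rewrite !dotE (dotC v u); lra.
have D0 : 0 <= favg f w - favg f xs by rewrite subr_ge0; exact: mf.
(* The negative square kept from cocoercivity pays for [SA], since
   [beta * (eta * T%:R * L) ^+ 2 <= 1]. *)
have eA : eta * (L * (beta * eta ^+ 2 * T%:R ^+ 2 * SA)) <= eta * (L^-1 * SA).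
  rewrite ler_pM2l// -(ler_pM2l L0) [L * (L^-1 * _)]mulrA divff ?gt_eqF// mul1r.
  by have := ler_wpM2r SA0 hS; rewrite mul1r; lra.
(* The same bound multiplied by [alpha / beta] turns the middle tails into the gap at [w]. *)
have eB : eta * (L * (alpha * eta ^+ 2 * T%:R ^+ 2 * SB)) <=
    2 * h * (alpha / beta) * (favg f w - favg f xs).
  apply: (@le_trans _ _ (eta * (L * (alpha * eta ^+ 2 * T%:R ^+ 2 *
     (2 * L * T%:R * (favg f w - favg f xs)))))).
    rewrite ler_pM2l// ler_pM2l// ler_wpM2l// !mulr_ge0 ?ltW// exprn_gt0//.
  have := ler_wpM2r D0 hS; rewrite mul1r => h1.
  have ca : 0 <= 2 * h * (alpha / beta).
    by rewrite mulr_ge0 ?divr_ge0 ?mulr_ge0 ?ltW.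
  have := ler_wpM2l ca h1.
  suff -> : 2 * h * (alpha / beta) *
    (beta * (eta * T%:R * L) ^+ 2 * (favg f w - favg f xs)) =
    eta * (L * (alpha * eta ^+ 2 * T%:R ^+ 2 *
     (2 * L * T%:R * (favg f w - favg f xs)))) by [].
  by rewrite /h; field; rewrite gt_eqF.
have SCE : SC = T%:R * sigma2 f xs by rewrite mulr_sigma2.
have := ler_wpM2l (ltW e0) sum_t; rewrite -!mulr_favg//.
rewrite dotZl in dist; rewrite SCE invfM => sum_e.
rewrite /h in eB *.
have eA2 : eta * (2^-1 * (L^-1 * SA)) = 2^-1 * (eta * (L^-1 * SA)) by ring.
lra.
Qed.

End one_epoch.
End inexact_epoch.

(** * Weights of the epochs and their power-law bounds *)

Section weights.
Context {R : realType}.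
Implicit Types (r s x : R) (n K : nat).

(* [weight r n] belongs to the epoch that has [n.+1] epochs left, itself
   included; it solves the recursion [mul_weightS] that balances the
   coefficients of the function values in [last_iterate]. *)
Fixpoint weight r n : R := if n is m.+1 then
  weight r m * ((1 + r) * m.+1%:R / (1 + (1 + r) * m.+1%:R)) else 1.

Lemma mulr_natS_gt0 r n : 0 <= r -> 0 < (1 + r) * n.+1%:R.
Proof. by move=> r0; rewrite mulr_gt0 ?ltr0Sn//; lra. Qed.

Lemma weight_gt0 r n : 0 <= r -> 0 < weight r n.
Proof.
move=> r0; elim: n => //= n ih; have u0 := mulr_natS_gt0 r n r0.
by rewrite mulr_gt0// divr_gt0//; lra.
Qed.

Lemma mul_weightS r n : 0 <= r ->
  (1 + (1 + r) * n.+1%:R) * weight r n.+1 = (1 + r) * n.+1%:R * weight r n.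
Proof.
move=> r0 /=; have := mulr_natS_gt0 r n r0; set u := (1 + r) * n.+1%:R => u0.
by field; rewrite gt_eqF//; lra.
Qed.

(** By [mul_weightS] the right-hand side grows by exactly [r * weight r n.+1] from [n] to [n.+1], as
    does the left-hand side. *)
Lemma sum_weight r n : 0 <= r ->
  r * \sum_(m < n.+1) weight r m <= (1 + r) * n.+1%:R * weight r n.
Proof.
move=> r0; elim: n => [|n ih]; first by rewrite big_ord_recr big_ord0 /=; lra.
rewrite big_ord_recr mulrDr [n.+2%:R]mulrS /=.
by have := mul_weightS r n r0; rewrite /=; lra.
Qed.

(** Young's inequality with exponents [s^-1] and [(1 - s)^-1], applied to the product of the power
    and 1. *)
Lemma powR_le_Bernoulli x s : 0 <= 1 + x -> 0 < s -> s < 1 ->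
  (1 + x) `^ s <= 1 + s * x.
Proof.
move=> x0 s0 s1; have s10 : 0 < 1 - s by lra.
have := @conjugate_powR _ ((1 + x) `^ s) 1 s^-1 (1 - s)^-1 (powR_ge0 _ _) ler01.
rewrite !invr_gt0 !invrK mulr1 -powRrM divff ?gt_eqF// powRr1// powR1.
by move=> /(_ s0 s10 _); lra.
Qed.

(** Each factor of [weight] is [(1 + s * n.+1%:R^-1)^-1], which Bernoulli's inequality compares with
    the ratio of consecutive powers. *)
Lemma weight_le_powR r n : 0 < r -> weight r n <= (n.+1%:R `^ (1 / (1 + r)))^-1.
Proof.
move=> r0; have r1 : 0 < 1 + r by lra.
set s := 1 / (1 + r).
have s0 : 0 < s by rewrite divr_gt0.
have s1 : s < 1 by rewrite ltr_pdivrMr//; lra.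
elim: n => [|n ih]; first by rewrite powR1 invr1.
have n0 : 0 < n.+1%:R :> R by rewrite ltr0Sn.
have -> : n.+2%:R = n.+1%:R * (1 + n.+1%:R^-1) :> R.
  by rewrite [n.+2%:R]mulrS; field; rewrite gt_eqF.
have i0 : 0 < n.+1%:R^-1 :> R by rewrite invr_gt0.
have i1 : 0 < 1 + n.+1%:R^-1 :> R by rewrite addr_gt0.
rewrite (powRM _ (ltW n0) (ltW i1)).
rewrite invfM /=; apply: ler_pM => //.
- exact/ltW/weight_gt0/ltW.
- by rewrite divr_ge0// ?addr_ge0// ltW// mulr_natS_gt0// ltW.
have := powR_le_Bernoulli (n.+1%:R^-1) s.
have p0 : 0 < (1 + n.+1%:R^-1 : R) `^ s by rewrite powR_gt0.
have -> : (1 + r) * n.+1%:R / (1 + (1 + r) * n.+1%:R) =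
    (1 + s * n.+1%:R^-1)^-1 :> R.
  rewrite /s; field; rewrite -mulrS !gt_eqF// addr_gt0//.
  by have := mulr_natS_gt0 r n (ltW r0).
move=> /(_ (ltW i1) s0 s1) h; rewrite lef_pV2 ?posrE//.
by rewrite addr_gt0// mulr_gt0.
Qed.

Lemma natr_mul_weight_le r n : 0 < r ->
  n.+1%:R * weight r n <= n.+1%:R `^ (r / (1 + r)).
Proof.
move=> r0; have n0 : 0 < n.+1%:R :> R by rewrite ltr0Sn.
have -> : r / (1 + r) = 1 - 1 / (1 + r) :> R by field; rewrite gt_eqF//; lra.
rewrite powRB; last by rewrite pnatr_eq0 implybT.
rewrite powRr1 ?ler0n// ler_pM2l//.
exact: weight_le_powR.
Qed.

End weights.

(** * Last-iterate inequality for an abstract sequence *)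

Section last_iterate.
Context {R : realType} {d : nat}.
Implicit Types (x : nat -> 'rV[R]_d) (delta rho : nat -> R).

(* Each new anchor is a convex combination of the old one and the new iterate;
   this shrinks the squared distance by the factor (1 - q) ^+ 2, of which only
   one factor (1 - q) is needed by the weights. The other one absorbs the cross
   term 2 * delta * Y. *)
Lemma last_iterate (F : 'rV[R]_d -> R) x delta rho (h r : R) (K : nat) :
  0 <= r -> 0 < h ->
  (forall a y z, 0 <= a -> a <= 1 ->
     F (a *: y + (1 - a) *: z) <= a * F y + (1 - a) * F z) ->
  (forall k z, (k < K)%N -> 2 * h * F (x k.+1) <= 2 * h * (1 + r) * F z
     + enorm (x k - z) ^+ 2 - enorm (x k.+1 - z) ^+ 2
     + 2 * delta k * enorm (x k.+1 - z) + rho k) ->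
  forall n z, (n < K)%N -> 2 * h * F (x K) <=
    weight r n * enorm (x (K - n.+1)%N - z) ^+ 2
    + 2 * h * ((1 + r) * n.+1%:R * weight r n) * F z
    + \sum_(m < n.+1) weight r m *
       (delta (K - m.+1)%N ^+ 2 * (1 + (1 + r) * m%:R) + rho (K - m.+1)%N).
Proof.
move=> r0 h0 cF step; elim=> [|n ih] z nK.
  have := step (K - 1)%N z; rewrite subnSK// subn0 leqnn.
  rewrite big_ord_recr big_ord0 /= => /(_ isT).
  have := sqr_ge0 (enorm (x K - z) - delta (K - 1)%N).
  rewrite sqrrB; lra.
have := step (K - n.+2)%N z.
rewrite subnSK// leq_subr => /(_ isT).
set k := (K - n.+2)%N; set y := x (K - n.+1)%N; set Y := enorm (y - z) => st.
have u0 := mulr_natS_gt0 r n r0; set u := (1 + r) * n.+1%:R in u0.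
have u1 : 0 < 1 + u by lra.
(* This [q] makes both [V * (1 - q)] and [u * V * q] equal to [V'], so the term in [F y] left by
   convexity is exactly the one bounded by the epoch inequality with weight [V']. *)
pose q := (1 + u)^-1.
have q0 : 0 < q by rewrite invr_gt0.
have q1 : q <= 1 by rewrite invf_le1//; lra.
have := ih (q *: y + (1 - q) *: z) (ltnW nK); rewrite -/y.
have -> : enorm (y - (q *: y + (1 - q) *: z)) ^+ 2 = (1 - q) ^+ 2 * Y ^+ 2.
  have -> : y - (q *: y + (1 - q) *: z) = (1 - q) *: (y - z).
    by apply/rowP => i; rewrite !mxE; ring.
  by rewrite !sqr_enorm dotZl dotZr; ring.
rewrite -/u [X in _ -> _ <= _ + X]big_ord_recr.
rewrite -[nat_of_ord ord_max]/n.+1 -/k -/u.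
set S := \sum_(m < n.+1) _; set V := weight r n.
have V'0 := weight_gt0 r n.+1 r0.
have VE : (1 + u) * weight r n.+1 = u * V by exact: mul_weightS.
set V' := weight r n.+1 in V'0 VE *.
have qE : q * (1 + u) = 1 by rewrite mulVf// gt_eqF.
have V1 : V * (1 - q) = V'.
  apply: (mulfI (_ : 1 + u != 0)); first by rewrite gt_eqF.
  have -> : (1 + u) * (V * (1 - q)) = (1 + u) * V - V * (q * (1 + u)) by ring.
  by rewrite qE VE; ring.
have quV : u * V * q = V' by rewrite -VE mulrC mulrA qE mul1r.
have cf := cF q y z (ltW q0) q1.
have hu : 0 <= 2 * h * (u * V) 
  by rewrite -VE mulr_ge0 ?(ltW (mulr_gt0 u1 V'0))// mulr_ge0// ltW.
have := ler_wpM2l hu cf.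
have -> : 2 * h * (u * V) * (q * F y + (1 - q) * F z) =
    2 * h * V' * F y + 2 * h * (u * V - V') * F z by rewrite -quV; ring.
have -> : V * ((1 - q) ^+ 2 * Y ^+ 2) = V' * (1 - q) * Y ^+ 2.
  by rewrite -V1; ring.
have -> : (1 + r) * n.+2%:R = u + (1 + r) by rewrite /u [n.+2%:R]mulrS; ring.
have young : - q * Y ^+ 2 + 2 * delta k * Y <= delta k ^+ 2 * (1 + u).
  have := sqr_ge0 (q * Y - delta k) => sq.
  have := mulr_ge0 (ltW u1) sq.
  have -> : (1 + u) * (q * Y - delta k) ^+ 2 = q * Y ^+ 2 * (q * (1 + u))
     - 2 * delta k * Y * (q * (1 + u)) + delta k ^+ 2 * (1 + u) by ring.
  by rewrite qE; lra.
have := ler_wpM2l (ltW V'0) young.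
have := ler_wpM2l (ltW V'0) st.
rewrite -VE.
set W := F (q *: y + _); set FK := F (x K).
rewrite [X in _ <= _ + X](_ : _ = S + V' * (delta k ^+ 2 * (1 + u) + rho k))//.
lra.
Qed.

End last_iterate.

(** * Last-iterate inequality for the proximal method *)

Section last_iterate_ipm.
Context {R : realType} {d T : nat}.
Variables (f : 'I_T -> 'rV[R]_d -> R) (L : R) (xs : 'rV[R]_d).
Variables (alpha beta eta : R).
Hypotheses (I : is_instance f L xs) (A : admissible T alpha beta eta L).
Variables (K : nat) (eps : nat -> 'I_T -> R) (x0 xK : 'rV[R]_d).
Hypothesis out : ipm_output f K (fun=> eta) eps x0 xK.

Local Notation h := (eta * T%:R).
Local Notation r := (alpha / beta).
Local Notation delta k := (\sum_(t < T) eps k t).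

(** [last_iterate] at [n = K.-1] with anchor [xs], where the gap of [favg] is 0 and the middle term
    disappears. *)
Lemma ipm_last_iterate : (0 < K)%N ->
  2 * h * (favg f xK - favg f xs) <=
  weight r K.-1 * enorm (x0 - xs) ^+ 2
  + \sum_(m < K) weight r m *
     (delta (K - m.+1)%N ^+ 2 * (1 + (1 + r) * m%:R + 2 * h * L)
      + 2 * h ^+ 3 * L * sigma2 f xs).
Proof.
move=> K0; case: out => x [z [x0E ep ->]].
have [T0 L0 cf sf mf] := I; have [a0 b0 ab e0 eL] := A.
have TR : 0 < T%:R :> R by rewrite ltr0n.
have h0 : 0 < h by rewrite mulr_gt0.
have r0 : 0 <= r by rewrite divr_ge0 ?ltW.
have := @last_iterate _ _ (fun y => favg f y - favg f xs) x
  (fun k => delta k) (fun k => 2 * h * L * delta k ^+ 2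
     + 2 * h ^+ 3 * L * sigma2 f xs) h r K r0 h0.
have cF a y w : 0 <= a -> a <= 1 ->
    favg f (a *: y + (1 - a) *: w) - favg f xs <=
    a * (favg f y - favg f xs) + (1 - a) * (favg f w - favg f xs).
  by move=> a00 a1; have := favg_convex f a y w cf a00 a1; lra.
move=> /(_ cF) H; lapply H; last first.
  move=> k w kK.
  have [zk hz ->] := ep k kK; rewrite -zk.
  have [p hp] := choice (fun t => let: ex_intro2 q q1 q2 := hz t in
    ex_intro (fun q => _ /\ _) q (conj q1 q2)).
  have := @epoch_descent _ _ _ f L xs alpha beta eta I A (z k) p (eps k)
    (fun t => (hp t).1) (fun t => (hp t).2) w.
  lra.
move=> {H} /(_ K.-1 xs); rewrite prednK// subnn subrr mulr0 addr0 x0E.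
move=> /(_ (leqnn K)) H; apply: le_trans H _; rewrite lerD2l.
by apply: ler_sum => m _; rewrite ler_wpM2l ?(ltW (weight_gt0 _ _ _))//; lra.
Qed.

End last_iterate_ipm.

(** * The error bound for a fixed step size *)

Section error_bound.
Context {R : realType} {d T : nat}.

(** Cauchy-Schwarz against the all-ones vector. *)
Lemma sqr_sum_le (e : 'I_T -> R) :
  (\sum_(t < T) e t) ^+ 2 <= T%:R * \sum_(t < T) e t ^+ 2.
Proof.
have := sqr_dot_le (const_mx 1) (\row_t e t).
rewrite /dot; under eq_bigr do rewrite !mxE mul1r.
under [X in _ <= X * _]eq_bigr do rewrite !mxE mulr1.
under [X in _ <= _ * X]eq_bigr do rewrite !mxE -expr2.
by rewrite sumr_const card_ord.
Qed.

Lemma ipm_error_bound (f : 'I_T -> 'rV[R]_d -> R) (L : R) (xs : 'rV[R]_d)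
    (alpha beta eta : R) (K : nat) (eps : nat -> 'I_T -> R) (x0 xK : 'rV[R]_d) :
  is_instance f L xs -> admissible T alpha beta eta L -> (0 < K)%N ->
  positive_accuracies K eps -> accuracy1 K alpha beta eta eps ->
  ipm_output f K (fun=> eta) eps x0 xK ->
  favg f xK - favg f xs <= error_bound f L K alpha beta eta eps x0 xs.
Proof.
move=> I A K0 pos acc out.
have := ipm_last_iterate _ _ _ _ _ _ I A _ _ _ _ out K0.
have hS := admissible_sqr _ _ _ _ _ _ A.
have [T0 L0 cf sf mf] := I; have [a0 b0 ab e0 eL] := A.
have {}hS := hS T0 L0.
have TR : 0 < T%:R :> R by rewrite ltr0n.
set h := eta * T%:R; set r := alpha / beta.
have h0 : 0 < h by rewrite mulr_gt0.
have r0 : 0 < r by rewrite divr_gt0.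
have s0 : 0 <= sigma2 f xs.
  rewrite mulr_ge0 ?invr_ge0// sumr_ge0// => t _; exact: sqr_ge0.
have b2 : 2 <= beta.
  have : 1 / beta <= 1 / 2 by apply: le_trans ab; rewrite lerDr divr_ge0 ?ltW.
  by rewrite !div1r lef_pV2 ?posrE.
have hL : h * L <= 1.
  rewrite -(@expr_le1 _ 2)// ?(ltW (mulr_gt0 h0 L0))//.
  by have := sqr_ge0 (eta * T%:R * L); rewrite /h; nra.
set D := enorm (x0 - xs) ^+ 2.
have D0 : 0 <= D by exact: sqr_ge0.
have e1 : 1 <= expR 1 :> R by have := expR_ge1Dx (1 : R); lra.
set Err := \sum_(k < K) \sum_(t < T)
      (2 * T%:R * eps k t ^+ 2 + Num.sqrt eta * eps k t)
      / (K - k)%:R `^ (1 / (1 + r)).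
(* Epoch [k] has [K - k] epochs left; the sum is reindexed by [m = K - k.+1] to match the
   weights. *)
have ErrE : Err = \sum_(m < K) ((m.+1%:R `^ (1 / (1 + r)))^-1 *
    \sum_(t < T) (2 * T%:R * eps (K - m.+1)%N t ^+ 2
        + Num.sqrt eta * eps (K - m.+1)%N t)).
  rewrite /Err (reindex_inj rev_ord_inj) /=; apply: eq_bigr => m _.
  rewrite subKn// mulr_sumr; apply: eq_bigr => t _; exact: mulrC.
have fac0 (m : nat) : 0 <= 1 + (1 + r) * m%:R + 2 * h * L.
  have : 0 <= (1 + r) * m%:R by rewrite mulr_ge0//; lra.
  by have := mulr_gt0 h0 L0; lra.
(* One factor [delta] is traded for [Num.sqrt eta] by the accuracy condition, whose denominator
   [1 + (1 + r) * m.+1%:R] dominates. The rest, [2 * h * L * delta ^+ 2], is at most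
   [2 * delta ^+ 2] and goes into the sum of squares. *)
have main : \sum_(m < K) weight r m *
     ((\sum_(t < T) eps (K - m.+1)%N t) ^+ 2 * (1 + (1 + r) * m%:R + 2 * h * L))
     <= Err.
  rewrite ErrE; apply: ler_sum => m _; apply: ler_pM.
  - exact/ltW/weight_gt0/ltW.
  - by rewrite mulr_ge0 ?sqr_ge0.
  - exact: weight_le_powR.
  have mK : (K - m.+1 < K)%N by rewrite ltn_subrL.
  have := acc _ mK; rewrite subKn// -/r.
  have dp : 0 <= \sum_(t < T) eps (K - m.+1)%N t.
    by apply: sumr_ge0 => t _; exact/ltW/pos.
  have := sqr_sum_le (eps (K - m.+1)%N).
  rewrite big_split /= -!mulr_sumr.
  set dl := \sum_(t < T) eps _ t in dp *; set d2 := \sum_(t < T) _ ^+ 2.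
  move=> q1 q2; have u0 := mulr_natS_gt0 r m (ltW r0).
  have : dl * (1 + (1 + r) * m.+1%:R) <= Num.sqrt eta.
    by rewrite -ler_pdivlMr//; lra.
  rewrite -natr1 => q3.
  have q4 : dl * (1 + (1 + r) * m%:R) <= Num.sqrt eta.
    by apply: le_trans q3; rewrite ler_wpM2l//; lra.
  have := ler_wpM2l dp q4.
  have := ler_wpM2l (sqr_ge0 dl) hL.
  lra.
move=> H.
rewrite -(ler_pM2l (_ : 0 < 2 * h)) ?mulr_gt0//.
apply: (le_trans H); rewrite /error_bound -/r -/Err.
set P := K%:R `^ (1 / (1 + r)).
have KR : 0 < K%:R :> R by rewrite ltr0n.
have P0 : 0 < P by rewrite powR_gt0.
have -> : 2 * h * (expR 1 * enorm (x0 - xs) ^+ 2 / (2 * eta * T%:R * P) +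
     2 * eta ^+ 2 * T%:R ^+ 2 * sigma2 f xs * L * (1 + beta / alpha) *
     K%:R `^ (r / (1 + r)) + expR 1 / (2 * eta * T%:R) * Err) =
  expR 1 * (P^-1 * D) + 4 * h ^+ 3 * L * sigma2 f xs *
    ((1 + beta / alpha) * K%:R `^ (r / (1 + r))) + expR 1 * Err.
  by rewrite /h /D; field; rewrite !gt_eqF.
under eq_bigr do rewrite mulrDr.
rewrite big_split /= -mulr_suml addrA [X in X <= _]addrAC.
have Err0 : 0 <= Err.
  apply: le_trans main; apply: sumr_ge0 => m _.
  rewrite mulr_ge0 ?(ltW (weight_gt0 _ _ (ltW r0)))// mulr_ge0 ?sqr_ge0//.
have t1 : weight r K.-1 * D <= expR 1 * (P^-1 * D).
  have := weight_le_powR r K.-1 r0; rewrite prednK// -/P => wP.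
  have := ler_wpM2r D0 wP.
  have : 0 <= P^-1 * D by rewrite mulr_ge0// invr_ge0 ltW.
  nra.
have t3 : Err <= expR 1 * Err by nra.
(* [sum_weight] reduces the sum to the last weight; division by [r] produces
   [(1 + r) / r = 1 + beta / alpha]. *)
have t2 : \sum_(m < K) weight r m <= (1 + beta / alpha) * K%:R `^ (r / (1 + r)).
  have := natr_mul_weight_le r K.-1 r0; have := sum_weight r K.-1 (ltW r0).
  rewrite prednK// => q1 q2.
  rewrite -(ler_pM2l r0).
  have -> : r * ((1 + beta / alpha) * K%:R `^ (r / (1 + r))) =
     (1 + r) * K%:R `^ (r / (1 + r)) by rewrite /r; field; rewrite !gt_eqF.
  apply: le_trans q1 _; rewrite -mulrA ler_wpM2l//; lra.
have c0 : 0 <= 2 * h ^+ 3 * L * sigma2 f xs.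
  by rewrite mulr_ge0// mulr_ge0 ?(ltW L0)// mulr_ge0// exprn_ge0// ltW.
have := ler_wpM2l c0 t2.
have : 0 <= 2 * h ^+ 3 * L * sigma2 f xs * \sum_(m < K) weight r m.
  by rewrite mulr_ge0// sumr_ge0// => m _; exact/ltW/weight_gt0/ltW.
lra.
Qed.

End error_bound.

(** * The error bound under the second accuracy condition *)

Section accuracy2_bound.
Context {R : realType} {d T : nat}.

Lemma sum_sqr_min_le (e : R) (n : nat) : 0 < e ->
  \sum_(m < n) (Num.min e (3 * m.+1%:R)^-1) ^+ 2 <= 2 / 3 * e.
Proof.
move=> e0.
have min0 (m : nat) : 0 <= Num.min e (3 * m.+1%:R)^-1.
  by rewrite le_min (ltW e0) invr_ge0 mulr_ge0.
(* The two cases are the integral of [min e (1 / (3 x)) ^+ 2] over [0, n]. *)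
suff [_] : \sum_(m < n) (Num.min e (3 * m.+1%:R)^-1) ^+ 2 <= e ^+ 2 * n%:R /\
    \sum_(m < n) (Num.min e (3 * m.+1%:R)^-1) ^+ 2 <=
      if 1 <= 3 * e * n%:R then 2 / 3 * e - (9 * n%:R)^-1 else e ^+ 2 * n%:R.
  move=> h; apply: (le_trans h); case: ifPn => [_|].
    by rewrite gerBl invr_ge0 mulr_ge0.
  by rewrite -ltNge => c; have := ler_wpM2l (ltW e0) (ltW c); nra.
elim: n => [|n [ih1 ih2]].
  by rewrite big_ord0 !mulr0 ler10; split.
rewrite big_ord_recr /=; have mle1 : Num.min e (3 * n.+1%:R)^-1 ^+ 2 <= e ^+ 2.
  by rewrite ler_pXn2r ?nnegrE ?(ltW e0)// ge_min lexx.
have mle2 : Num.min e (3 * n.+1%:R)^-1 ^+ 2 <= (3 * n.+1%:R)^-1 ^+ 2.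
  by rewrite ler_pXn2r ?nnegrE ?invr_ge0 ?mulr_ge0// ge_min lexx orbT.
have h1 : \sum_(m < n) (Num.min e (3 * m.+1%:R)^-1) ^+ 2
    + Num.min e (3 * n.+1%:R)^-1 ^+ 2 <= e ^+ 2 * n.+1%:R.
  by rewrite -[in leRHS]natr1 mulrDr mulr1 lerD.
split=> //; case: ifPn => // c1.
set S := \sum_(m < n) _ in ih1 ih2 *.
have m0 : 0 < n.+1%:R :> R by [].
suff H : S <= 2 / 3 * e - (9 * n.+1%:R)^-1 - (3 * n.+1%:R)^-1 ^+ 2.
  by apply: le_trans (lerD H mle2) _; rewrite subrK.
move: ih2; case: ifPn => c2 ih2.
  have n0 : 0 < n%:R :> R.
    by rewrite lt_neqAle ler0n andbT eq_sym; apply: contraTneq c2 => ->;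
      rewrite mulr0 ler10.
  (* Beyond the threshold: 1/(9n) - 1/(9(n+1)) = 1/(9n(n+1)), which exceeds the square of
     1/(3(n+1)). *)
  apply: (le_trans ih2); rewrite -!addrA lerD2l -opprD lerN2.
  have -> : (9 * n%:R)^-1 = (9 * n.+1%:R)^-1 + (9 * (n%:R * n.+1%:R))^-1 :> R.
    by rewrite -natr1; field; rewrite nat1r !gt_eqF.
  rewrite lerD2l exprVn exprMn lef_pV2 ?posrE ?mulr_gt0 ?exprn_gt0//.
  by rewrite -natr1; nra.
(* The threshold is crossed between [n] and [n.+1], so [3 * e * n%:R < 1 <= 3 * e * n.+1%:R]. The
   gap then factors into two nonnegative terms over [9 * N ^+ 2]. *)
apply: (le_trans ih1).
have c3 : 3 * e * n%:R < 1 by rewrite ltNge.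
pose N : R := n.+1%:R; have nE : n%:R = N - 1 by rewrite /N -natr1 addrK.
rewrite nE in c3 *; rewrite -/N in c1 m0 *.
have y1 : 0 <= 3 * e * N - 1 by lra.
have y2 : 0 <= (N + 1) - (N - 1) * (3 * e * N).
  by have := ler_wpM2l (ltW m0) (ltW c3); lra.
have := mulr_ge0 y1 y2 => y3.
rewrite -subr_ge0.
have -> : 2 / 3 * e - (9 * N)^-1 - (3 * N)^-1 ^+ 2 - e ^+ 2 * (N - 1) =
  (3 * e * N - 1) * ((N + 1) - (N - 1) * (3 * e * N)) / (9 * N ^+ 2).
  by field; rewrite gt_eqF.
by rewrite divr_ge0// mulr_ge0// exprn_ge0// ltW.
Qed.

(** The power is at most the exponential of 1/10, and [1 - 1/10 <= expR (- (1 / 10))] bounds this by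
    10/9, below 9/8. *)
Lemma natr_mul_weight_le98 (r : R) (n K : nat) : 0 < r -> (n < K)%N ->
  r * ln K%:R <= 1 / 10 -> n.+1%:R * weight r n <= 9 / 8.
Proof.
move=> r0 nK rK; apply: le_trans (natr_mul_weight_le r n r0) _.
have n0 : 0 < n.+1%:R :> R by [].
have K0 : 0 < K%:R :> R by rewrite ltr0n (leq_ltn_trans _ nK).
rewrite /powR gt_eqF//.
have l0 : 0 <= ln n.+1%:R :> R by rewrite ln_ge0// ler1n.
have lK : ln n.+1%:R <= ln K%:R :> R by rewrite ler_ln ?posrE// ler_nat.
have h : r / (1 + r) * ln n.+1%:R <= 1 / 10.
  apply: le_trans rK; apply: ler_pM => //; first by rewrite divr_ge0//; lra.
  by rewrite ler_pdivrMr; nra.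
apply: (@le_trans _ _ (expR (1 / 10))); first by rewrite ler_expR.
rewrite -[leLHS]invrK -expRN -[leRHS]invrK lef_pV2 ?posrE ?invr_gt0 ?expR_gt0//.
by have := expR_ge1Dx (- (1 / 10) : R); lra.
Qed.

(** Since [r * ln K%:R] is small, [weight r m] is at most 9/8 divided by [m.+1]. All constants are
    halved by the final division by [2 * h]. *)
Lemma ipm_accuracy2_bound (f : 'I_T -> 'rV[R]_d -> R) (L : R) (xs : 'rV[R]_d)
    (alpha beta eta epsilon : R) (K : nat) (eps : nat -> 'I_T -> R)
    (x0 xK : 'rV[R]_d) :
  is_instance f L xs -> admissible T alpha beta eta L -> (0 < K)%N ->
  0 < epsilon -> positive_accuracies K eps -> accuracy2 K epsilon eta eps ->
  ipm_output f K (fun=> eta) eps x0 xK ->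
  alpha / beta <= 1 -> alpha / beta * ln K%:R <= 1 / 10 ->
  eta * T%:R * L <= 1 / 2 ->
  favg f xK - favg f xs <= 9 / 16 * (enorm (x0 - xs) ^+ 2 / (eta * T%:R * K%:R))
    + 9 / 8 * ((eta * T%:R) ^+ 2 * L * sigma2 f xs * (1 + beta / alpha))
    + 3 / 4 * epsilon.
Proof.
move=> I A K0 ep0 pos acc out r1 rK hL.
have := ipm_last_iterate _ _ _ _ _ _ I A _ _ _ _ out K0.
have [T0 L0 cf sf mf] := I; have [a0 b0 ab e0 eL] := A.
have TR : 0 < T%:R :> R by rewrite ltr0n.
have KR : 0 < K%:R :> R by rewrite ltr0n.
have rE : 1 + beta / alpha = (1 + alpha / beta) / (alpha / beta).
  by field; rewrite !gt_eqF.
rewrite rE; move: r1 rK (divr_gt0 a0 b0) => {rE}.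
set h := eta * T%:R in hL *; set r := alpha / beta => r1 rK r0.
have h0 : 0 < h by rewrite mulr_gt0.
have s0 : 0 <= sigma2 f xs.
  by rewrite mulr_ge0 ?invr_ge0// sumr_ge0// => t _; exact: sqr_ge0.
set D := enorm (x0 - xs) ^+ 2.
have D0 : 0 <= D by exact: sqr_ge0.
have w98 (m : nat) : (m < K)%N -> m.+1%:R * weight r m <= 9 / 8.
  by move=> mK; exact: (natr_mul_weight_le98 r m K).
have wK : K%:R * weight r K.-1 <= 9 / 8.
  by have := w98 K.-1; rewrite prednK// leqnn => /(_ isT).
have t1 : weight r K.-1 * D <= 9 / 8 * (D / K%:R).
  by rewrite [leRHS]mulrA ler_pdivlMr//; have := ler_wpM2r D0 wK; lra.
have t2 : \sum_(m < K) weight r m <= 9 / 8 * ((1 + r) / r).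
  have := sum_weight r K.-1 (ltW r0); rewrite prednK// => q1.
  rewrite [leRHS]mulrA ler_pdivlMr//.
  have : (1 + r) * (K%:R * weight r K.-1) <= (1 + r) * (9 / 8).
    by rewrite ler_wpM2l//; lra.
  lra.
have t3 : \sum_(m < K) weight r m *
    ((\sum_(t < T) eps (K - m.+1)%N t) ^+ 2 * (1 + (1 + r) * m%:R + 2 * h * L))
    <= 3 / 2 * (eta * epsilon).
  apply: (@le_trans _ _ (\sum_(m < K) 9 / 4 * eta *
      Num.min epsilon (3 * m.+1%:R)^-1 ^+ 2)); last first.
    rewrite -mulr_sumr.
    have e94 : 0 <= 9 / 4 * eta by lra.
    by have := ler_wpM2l e94 (sum_sqr_min_le epsilon K ep0); lra.
  apply: ler_sum => m _.
  have mK : (K - m.+1 < K)%N by rewrite ltn_subrL.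
  have := acc _ mK; rewrite subKn//.
  have : 0 <= \sum_(t < T) eps (K - m.+1)%N t.
    by apply: sumr_ge0 => t _; exact/ltW/pos.
  set dl := \sum_(t < T) _; set mn := Num.min _ _ => dl0 dle.
  have dl2 : dl ^+ 2 <= eta * mn ^+ 2.
    rewrite -[X in X * _](sqr_sqrtr (ltW e0)) -exprMn ler_pXn2r ?nnegrE//.
    exact: le_trans dl0 dle.
  have w0 := weight_gt0 r m (ltW r0).
  (* With [r <= 1] and [h * L <= 1 / 2] the bracket is at most [2 * (m%:R + 1)], so the growth in
     [m] cancels against the weight and 9/4 = 2 * 9/8 remains. *)
  have fac : weight r m * (1 + (1 + r) * m%:R + 2 * h * L) <= 9 / 4.
    have := w98 m (ltn_ord m); rewrite -natr1.
    have : weight r m * (1 + (1 + r) * m%:R + 2 * h * L) <=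
        weight r m * (2 * (m%:R + 1)).
      rewrite ler_pM2l//.
      have : (1 + r) * m%:R <= 2 * m%:R by rewrite ler_wpM2r//; lra.
      lra.
    lra.
  rewrite [leLHS]mulrCA [leLHS]mulrC -[leRHS]mulrA; apply: ler_pM => //.
  - rewrite mulr_ge0 ?(ltW w0)//.
    have : 0 <= (1 + r) * m%:R by rewrite mulr_ge0//; lra.
    by have := mulr_gt0 h0 L0; lra.
  - exact: sqr_ge0.
under eq_bigr do rewrite mulrDr.
rewrite big_split /= -mulr_suml => H.
have c0 : 0 <= 2 * h ^+ 3 * L * sigma2 f xs.
  by rewrite mulr_ge0// mulr_ge0 ?(ltW L0)// mulr_ge0// exprn_ge0// ltW.
have := ler_wpM2l c0 t2 => t2'.
have T1 : 1 <= T%:R :> R by rewrite ler1n.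
have eT : eta * epsilon <= h * epsilon.
  by rewrite ler_pM2r// /h ler_peMr// ltW.
rewrite -(ler_pM2l (_ : 0 < 2 * h)) ?mulr_gt0//.
have -> : 2 * h * (9 / 16 * (D / (h * K%:R)) +
   9 / 8 * (h ^+ 2 * L * sigma2 f xs * ((1 + r) / r)) + 3 / 4 * epsilon) =
  9 / 8 * (D / K%:R) + 2 * h ^+ 3 * L * sigma2 f xs * (9 / 8 * ((1 + r) / r))
   + 3 / 2 * (h * epsilon).
  by field; rewrite !gt_eqF.
lra.
Qed.
End accuracy2_bound.

(** * Choice of parameters and complexity *)

Section complexity.
Context {R : realType} {d T : nat}.
Variables (f : 'I_T -> 'rV[R]_d -> R) (L : R) (xs : 'rV[R]_d).
Hypothesis I : is_instance f L xs.

(** Isolates the factor after [T%:R], to which the number of epochs is proportional up to a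
    logarithm. *)
Lemma complexityE (epsilon : R) (x0 : 'rV[R]_d) : 0 < epsilon ->
  complexity f L epsilon x0 xs = T%:R * (enorm (x0 - xs) ^+ 2 / epsilon *
    (L + Num.sqrt L * Num.sqrt (sigma2 f xs) / Num.sqrt epsilon)).
Proof.
case: I => T0 L0 _ _ _ e0; rewrite /complexity.
have se : 0 < Num.sqrt epsilon by rewrite sqrtr_gt0.
have -> : epsilon `^ (3 / 2) = epsilon * Num.sqrt epsilon.
  have -> : 3 / 2 = 1 + 2^-1 :> R by field.
  by rewrite powRD ?(gt_eqF e0) ?implybT// powRr1 ?powR12_sqrt// ltW.
by rewrite div1r powR12_sqrt ?(ltW L0)//; field; rewrite !gt_eqF.
Qed.

(** Smoothness alone makes [x0] accurate enough; [alpha = beta = 4] and the largest step they allow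
    complete the witness. *)
Lemma ipm_zero_epochs (epsilon : R) (x0 : 'rV[R]_d) : 0 < epsilon ->
  L * enorm (x0 - xs) ^+ 2 <= 2 * epsilon ->
  admissible T 4 4 (1 / (Num.sqrt 4 * T%:R * L)) L /\
  forall eta (eps : nat -> 'I_T -> R) (xK : 'rV[R]_d),
    ipm_output f 0 eta eps x0 xK -> favg f xK - favg f xs <= epsilon.
Proof.
move=> e0 LD; have [T0 L0 _ _ _] := I; split.
  split=> //; first lra.
  by rewrite divr_gt0// !mulr_gt0 ?ltr0n// sqrtr_gt0.
move=> eta eps xK [x [z [x0E _ ->]]]; rewrite x0E.
by apply: le_trans (favg_sub_le _ _ _ _ I) _; lra.
Qed.

(* With [alpha / beta = (110 * l)^-1] the last bound keeps [K `^ (alpha / beta)]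
   below [9 / 8]. *)
Lemma ipm_parameters (gamma l : R) (K : nat) :
  2 < gamma -> l = ln (2 + gamma) ->
  K = (Num.truncn (200 * gamma * l)).+1 ->
  [/\ 1 <= l, 200 * gamma * l <= K%:R, K%:R <= 400 * gamma * l &
      (110 * l)^-1 * ln K%:R <= 1 / 10].
Proof.
move=> g2 lE KE.
have g0 : 0 < 2 + gamma by lra.
(* Amounts to e <= 4 < 2 + gamma; the bound e <= 4 follows from [1 - 1/2 <= expR (- (1 / 2))]. *)
have l1 : 1 <= l.
  rewrite lE -ler_expR lnK ?posrE//.
  have e2 : expR (1 / 2) <= 2 :> R.
    rewrite -[leLHS]invrK -expRN -[leRHS]invrK.
    rewrite lef_pV2 ?posrE ?invr_gt0 ?expR_gt0//.
    by have := expR_ge1Dx (- (1 / 2) : R); lra.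
  have -> : (1 : R) = 1 / 2 + 1 / 2 by field.
  rewrite expRD; have := expR_gt0 (1 / 2 : R); nra.
have gl : 2 <= gamma * l by nra.
have x0 : 0 <= 200 * gamma * l by nra.
have /andP[tK Kt] := truncn_itv x0.
have K1 : 200 * gamma * l <= K%:R by rewrite KE ltW.
have K2 : K%:R <= 400 * gamma * l by rewrite KE -natr1; lra.
split=> //.
have lg : l <= 2 + gamma by rewrite lE ltW// ln_sublinear.
have KR : 0 < K%:R :> R by rewrite KE.
(* Source of the 11 in [110 = 10 * 11]: 400 is below the ninth power of 4, and [gamma * l] takes two
   more powers of [2 + gamma]. *)
have K3 : K%:R <= (2 + gamma) ^+ 11.
  apply: le_trans K2 _.
  have q1 : gamma * l <= (2 + gamma) ^+ 2 by nra.
  have q2 : 4 ^+ 9 <= (2 + gamma) ^+ 9 by rewrite ler_pXn2r ?nnegrE//; lra.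
  have q3 : 400 <= (2 + gamma) ^+ 9 by apply: le_trans q2; lra.
  rewrite -mulrA (exprD _ 9 2); apply: ler_pM (ler0n _ 400) _ q3 q1.
  by apply: mulr_ge0; lra.
have lK : ln K%:R <= 11 * l.
  rewrite mulr_natl lE -lnXn// ler_ln ?posrE// exprn_gt0//.
have l0 : 0 < 110 * l by lra.
by rewrite mulrC ler_pdivrMr//; lra.
Qed.

Lemma ipm_complexity (epsilon : R) (x0 : 'rV[R]_d) : 0 < epsilon ->
  exists (K : nat) (alpha beta eta : R),
    [/\ (T * K)%:R <= polylog_bound 400 1 (complexity f L epsilon x0 xs),
        admissible T alpha beta eta L &
        forall (eps : nat -> 'I_T -> R) (xK : 'rV[R]_d),
          positive_accuracies K eps ->
          accuracy2 K epsilon eta eps ->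
          ipm_output f K (fun=> eta) eps x0 xK ->
          favg f xK - favg f xs <= epsilon].
Proof.
move=> ep0; have [T0 L0 cf sf mf] := I.
have TR : 0 < T%:R :> R by rewrite ltr0n.
have T1 : 1 <= T%:R :> R by rewrite ler1n.
rewrite complexityE//; set D := enorm (x0 - xs) ^+ 2.
have D0 : 0 <= D by exact: sqr_ge0.
have s0 : 0 <= sigma2 f xs.
  by rewrite mulr_ge0 ?invr_ge0// sumr_ge0// => t _; exact: sqr_ge0.
have se0 : 0 < Num.sqrt epsilon by rewrite sqrtr_gt0.
set Q := Num.sqrt L * Num.sqrt (sigma2 f xs) / Num.sqrt epsilon.
have Q0 : 0 <= Q by rewrite !mulr_ge0 ?sqrtr_ge0// invr_ge0 ltW.
have Q2 : Q ^+ 2 * epsilon = L * sigma2 f xs.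
  rewrite /Q !exprMn exprVn !sqr_sqrtr ?(ltW L0)// ?(ltW ep0)//.
  by rewrite divfK// gt_eqF.
set gamma := D / epsilon * (L + Q).
have De0 : 0 <= D / epsilon by rewrite divr_ge0// ltW.
have g0 : 0 <= gamma by rewrite mulr_ge0//; lra.
(* In the first case [gamma] may be too small to allow even one epoch; in the second it exceeds
   2. *)
have [LD|LD] := lerP (L * D) (2 * epsilon).
  have [adm bnd] := ipm_zero_epochs epsilon x0 ep0 LD.
  exists 0%N, 4, 4, (1 / (Num.sqrt 4 * T%:R * L)); split=> //.
    have Tg0 := mulr_ge0 (ltW TR) g0.
    rewrite muln0 /polylog_bound expr1; apply: mulr_ge0.
      exact: mulr_ge0 (ler0n _ 400) Tg0.
    by apply: ln_ge0; lra.
  by move=> eps xK _ _; exact: bnd.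
have g2 : 2 < gamma.
  apply: (@lt_le_trans _ _ (D / epsilon * L)).
    by rewrite mulrAC ltr_pdivlMr// [D * L]mulrC.
  by rewrite ler_wpM2l//; lra.
pose l := ln (2 + gamma).
pose K := (Num.truncn (200 * gamma * l)).+1.
have [l1 K1 K2 rK] := ipm_parameters gamma l K g2 erefl erefl.
(* [B = 1 + 1 / r], so [alpha = r * (2 * B)] and [beta = 2 * B] have ratio [r] and satisfy
   [1 / alpha + 1 / beta = 1 / 2]. *)
pose B := 1 + 110 * l; pose r := (110 * l)^-1.
have B1 : 1 <= B by rewrite /B; lra.
have l0 : 0 < 110 * l by lra.
have r0 : 0 < r by rewrite invr_gt0.
have sB1 : 1 <= Num.sqrt B by rewrite -[leLHS]sqrtr1 ler_sqrt//; lra.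
have sB2 : Num.sqrt B ^+ 2 = B by rewrite sqr_sqrtr//; lra.
(* [N] is the inverse of [eta * T%:R]. Its part in [L] ensures admissibility, as
   [Num.sqrt (2 * B) <= 3 * Num.sqrt B]; its part in [Q] controls the variance term. *)
pose N := 3 * Num.sqrt B * (L + Q).
have N0 : 0 < N by rewrite !mulr_gt0//; lra.
pose eta := (N * T%:R)^-1.
have hE : eta * T%:R = N^-1 by rewrite /eta; field; rewrite !gt_eqF.
have abE : r * (2 * B) / (2 * B) = r by rewrite mulfK// gt_eqF//; lra.
have A : admissible T (r * (2 * B)) (2 * B) eta L.
  split.
  - by rewrite !mulr_gt0//; lra.
  - by rewrite mulr_gt0//; lra.
  - rewrite le_eqVlt; apply/orP; left; apply/eqP.
    rewrite /r /B; field; rewrite !gt_eqF//; lra.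
  - by rewrite invr_gt0 mulr_gt0.
  - have sb0 : 0 < Num.sqrt (2 * B) by rewrite sqrtr_gt0; lra.
    have p1 : 0 < N * T%:R by rewrite mulr_gt0.
    have p2 : 0 < Num.sqrt (2 * B) * T%:R * L by rewrite !mulr_gt0.
    rewrite /eta div1r lef_pV2 ?posrE// mulrAC ler_pM2r//.
    have sB : Num.sqrt (2 * B) <= 3 * Num.sqrt B.
      have s3 : 0 <= 3 * Num.sqrt B by lra.
      rewrite -(@ler_pXn2r _ 2)// ?nnegrE ?sqrtr_ge0// exprMn sB2.
      by rewrite sqr_sqrtr; lra.
    apply: (@le_trans _ _ (3 * Num.sqrt B * L)); first by rewrite ler_pM2r.
    by rewrite /N ler_wpM2l//; lra.
exists K, (r * (2 * B)), (2 * B), eta; split=> //.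
  have Tg : gamma <= T%:R * gamma by rewrite ler_peMl.
  have ll : l <= ln (2 + T%:R * gamma) by rewrite /l ler_ln ?posrE; lra.
  rewrite /polylog_bound expr1 natrM.
  have -> : 400 * (T%:R * gamma) * ln (2 + T%:R * gamma) =
    T%:R * (400 * gamma * ln (2 + T%:R * gamma)) by ring.
  rewrite ler_pM2l//; apply: (le_trans K2).
  exact: ler_wpM2l (mulr_ge0 (ler0n _ 400) g0) _ _ ll.
move=> eps xK pos acc out.
have bnd := @ipm_accuracy2_bound _ _ _ f L xs (r * (2 * B)) (2 * B) eta epsilon
  K eps x0 xK I A isT ep0 pos acc out.
rewrite abE in bnd.
have r1 : r <= 1 by rewrite invf_le1//; lra.
have hL : eta * T%:R * L <= 1 / 2.
  rewrite hE mulrC ler_pdivrMr// /N; nra.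
apply: (le_trans (bnd r1 rK hL)).
have -> : 1 + 2 * B / (r * (2 * B)) = B.
  rewrite /r /B; field; rewrite !gt_eqF//; lra.
rewrite hE -/D.
have KR : 0 < K%:R :> R by [].
(* 33/200 is [3 * 11 * l] from [3 * Num.sqrt B], divided by the [200 * l] in the lower bound on
   [K]. *)
have t1 : D / (N^-1 * K%:R) <= 33 / 200 * epsilon.
  have -> : D / (N^-1 * K%:R) = 3 * Num.sqrt B * (gamma * epsilon) / K%:R.
    by rewrite /gamma /N; field; rewrite !gt_eqF//; lra.
  rewrite ler_pdivrMr//.
  have sB : Num.sqrt B <= 11 * l.
    have l11 : 0 <= 11 * l by lra.
    by rewrite -(@ler_pXn2r _ 2)// ?nnegrE ?sqrtr_ge0// sB2 /B; nra.
  have ge0 : 0 <= gamma * epsilon by rewrite mulr_ge0// ltW.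
  have := ler_wpM2r ge0 sB; have := ler_wpM2l (ltW ep0) K1.
  lra.
have t2 : N^-1 ^+ 2 * L * sigma2 f xs * B <= epsilon / 9.
  have -> : N^-1 ^+ 2 * L * sigma2 f xs * B = Q ^+ 2 * epsilon * B / N ^+ 2.
    by rewrite Q2 exprVn; ring.
  rewrite ler_pdivrMr ?exprn_gt0//.
  have -> : N ^+ 2 = 9 * B * (L + Q) ^+ 2 by rewrite -sB2 /N; ring.
  have : Q ^+ 2 <= (L + Q) ^+ 2 by rewrite ler_pXn2r ?nnegrE//; lra.
  have eB : 0 <= epsilon * B by rewrite mulr_ge0; lra.
  move=> /(ler_wpM2l eB); lra.
(* The three contributions are 9/16 * 33/200, 9/8 * 1/9 and 3/4 of [epsilon]; their sum is below
   1. *)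
lra.
Qed.

End complexity.

Theorem corollary3p4 (R : realType) :
  (forall (d T : nat) (f : 'I_T -> 'rV[R]_d -> R) (L : R) (xs : 'rV[R]_d),
     is_instance f L xs ->
     forall alpha beta eta : R, admissible T alpha beta eta L ->
     forall (K : nat) (eps : nat -> 'I_T -> R) (x0 xK : 'rV[R]_d),
       (0 < K)%N ->
       positive_accuracies K eps ->
       accuracy1 K alpha beta eta eps ->
       ipm_output f K (fun=> eta) eps x0 xK ->
       favg f xK - favg f xs <= error_bound f L K alpha beta eta eps x0 xs)
  /\
  (exists (C : R) (p : nat), 0 < C /\
     forall (d T : nat) (f : 'I_T -> 'rV[R]_d -> R) (L : R) (xs : 'rV[R]_d),
     is_instance f L xs ->
     forall (x0 : 'rV[R]_d) (epsilon : R), 0 < epsilon ->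
     exists (K : nat) (alpha beta eta : R),
       [/\ (T * K)%:R <= polylog_bound C p (complexity f L epsilon x0 xs),
           admissible T alpha beta eta L &
           forall (eps : nat -> 'I_T -> R) (xK : 'rV[R]_d),
             positive_accuracies K eps ->
             accuracy2 K epsilon eta eps ->
             ipm_output f K (fun=> eta) eps x0 xK ->
             favg f xK - favg f xs <= epsilon]).
Proof.
split=> [d T f L xs I alpha beta eta A K eps x0 xK K0 pos acc out|].
  exact: ipm_error_bound I A K0 pos acc out.
exists 400, 1%N; split=> [|d T f L xs I x0 epsilon e0]; first exact: ltr0Sn.
exact: ipm_complexity I _ _ e0.
Qed.
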